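(* Let $\mathfrak{P}$ and $\mathfrak{Q}$ be topological properties such that: (i) $\mathfrak{P}$ and $\mathfrak{Q}$ are closed hereditary; (ii) a space with both $\mathfrak{P}$ and $\mathfrak{Q}$ is Lindelöf; (iii) $\mathfrak{P}$ is preserved under countable closed sums; (iv) a space with $\mathfrak{Q}$ having a dense subspace with $\mathfrak{P}$ has $\mathfrak{P}$. Let $X$ be a locally-$\mathfrak{P}$ space with $\mathfrak{Q}$. (1) Let $X$ be regular. Then \[C^\mathfrak{P}_0(X)=\big\{f\in C_b(X):\mathrm{supp}(f)\text{ has }\mathfrak{P}\big\}=C^\mathfrak{P}_{00}(X).\] (2) Let $X$ be normal. Then $C^\mathfrak{P}_0(X)$ is a Banach algebra isometrically isomorphic to $C_0(Y)$ for some unique (up to homeomorphism) locally compact Hausdorff space $Y$, namely $Y=\lambda_\mathfrak{P}X$. Furthermore, $Y$ is countably compact and $C_0(Y)=C_{00}(Y)$.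
   Context: A space is a topological space; normal spaces are taken to be Hausdorff, and $\beta X$ is the Stone–Čech compactification of $X$, containing $X$ as a dense subspace. $C_b(X)$ is the normed algebra of continuous bounded $f:X\to\mathbb{R}$ with pointwise operations and the supremum norm; $\mathrm{coz}(f)=X\setminus f^{-1}(0)$, $\mathrm{supp}(f)=\mathrm{cl}_X\mathrm{coz}(f)$, and $\mathrm{Coz}(X)$ is the set of all cozero-sets of continuous real-valued functions on $X$. $C_{00}(Y)$ is the set of continuous bounded $f:Y\to\mathbb{R}$ with compact support, and $C_0(Y)$ the set of those with $|f|^{-1}([1/n,\infty))$ compact for each positive integer $n$. A neighborhood of a set $A$ in $X$ is a set $U\subseteq X$ with $A\subseteq\mathrm{int}_XU$. A space is countably compact if every countable open cover has a finite subcover. A topological property is closed hereditary if every closed subspace of a space with the property has the property; it is preserved under countable closed sums if every space which is a countable union of closed subspaces each having the property has the property. A space is locally-$\mathfrak{P}$ if each of its points has a neighborhood (in the space) with $\mathfrak{P}$. $\mathscr{I}_\mathfrak{P}=\{A\subseteq X:\mathrm{cl}_XA\text{ has }\mathfrak{P}\}$; its elements are called null. $C^\mathfrak{P}_{00}(X)=\{f\in C_b(X):\mathrm{supp}(f)\text{ has a null neighborhood in }X\}$ and $C^\mathfrak{P}_0(X)=\{f\in C_b(X):|f|^{-1}([1/n,\infty))\text{ has a null neighborhood in }X\text{ for each positive integer }n\}$. $\lambda_\mathfrak{P}X=\bigcup\{\mathrm{int}_{\beta X}\mathrm{cl}_{\beta X}C:C\in\mathrm{Coz}(X)\text{ and }\mathrm{cl}_XC\text{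 has a null neighborhood in }X\}$, considered as a subspace of $\beta X$. ''Isometrically isomorphic'' means by an isometric algebra isomorphism. *)

(* Defs.v *)
From HB Require Import structures.
From mathcomp Require Import all_boot all_order all_algebra.
From mathcomp Require Import all_classical all_reals all_analysis.

Set Implicit Arguments.
Unset Strict Implicit.
Unset Printing Implicit Defensive.

Import Order.TTheory GRing.Theory Num.Theory.
Import numFieldNormedType.Exports.

Local Open Scope classical_set_scope.
Local Open Scope ring_scope.

(* Throughout, a subset [A : set T] used as a space is [set_type A] with the
   initial topology of the inclusion (the library's subtype topology). *)

Definition homeomorphic (T U : topologicalType) : Prop :=
  exists (f : T -> U) (g : U -> T),
    [/\ continuous f, continuous g, cancel f g & cancel g f].

Definition topological_property (P : topologicalType -> Prop) : Prop :=
  forall T U : topologicalType, homeomorphic T U -> P T -> P U.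

Definition closed_hereditary (P : topologicalType -> Prop) : Prop :=
  forall (T : topologicalType) (A : set T), closed A -> P T -> P A.

(* [countable] includes finite and empty families; in particular the empty
   space, the union of the empty family, has [P]. *)
Definition preserved_under_countable_closed_sums
    (P : topologicalType -> Prop) : Prop :=
  forall (T : topologicalType) (F : set (set T)),
    countable F -> (forall A, F A -> closed A /\ P A) ->
    \bigcup_(A in F) A = [set: T] -> P T.

Definition lindelof (T : topologicalType) : Prop :=
  forall F : set (set T), (forall A, F A -> open A) ->
    \bigcup_(A in F) A = [set: T] ->
    exists G : set (set T),
      [/\ G `<=` F, countable G & \bigcup_(A in G) A = [set: T]].

Definition countably_compact (T : topologicalType) : Prop :=
  forall F : set (set T), countable F -> (forall A, F A -> open A) ->
    \bigcup_(A in F) A = [set: T] ->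
    exists G : set (set T),
      [/\ G `<=` F, finite_set G & \bigcup_(A in G) A = [set: T]].

Definition locally_property (P : topologicalType -> Prop)
    (X : topologicalType) : Prop :=
  forall x : X, exists2 U : set X, nbhs x U & P U.

Definition null (P : topologicalType -> Prop) (X : topologicalType)
    (A : set X) : Prop := P (closure A).

Definition has_null_neighborhood (P : topologicalType -> Prop)
    (X : topologicalType) (A : set X) : Prop :=
  exists2 U : set X, A `<=` U° & null P U.

Section FunctionSpaces.
Variables (R : realType) (X : topologicalType).
Implicit Types f g : X -> R.

Definition Cb : set (X -> R) := [set f | continuous f /\ bounded_fun f].

Definition coz f : set X := ~` (f @^-1` [set 0]).

Definition supp f : set X := closure (coz f).

Definition Coz : set (set X) :=
  [set C | exists2 f : X -> R, continuous f & C = coz f].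

(* The set |f|^-1([1/n, oo)) *)
Definition superlevel f (n : nat) : set X := [set x | n%:R^-1 <= `|f x|].

Definition C00 : set (X -> R) := [set f | Cb f /\ compact (supp f)].

Definition C0 : set (X -> R) :=
  [set f | Cb f /\ forall n, (0 < n)%N -> compact (superlevel f n)].

Definition CP00 (P : topologicalType -> Prop) : set (X -> R) :=
  [set f | Cb f /\ has_null_neighborhood P (supp f)].

Definition CP0 (P : topologicalType -> Prop) : set (X -> R) :=
  [set f | Cb f /\
    forall n, (0 < n)%N -> has_null_neighborhood P (superlevel f n)].

End FunctionSpaces.

Arguments Cb : clear implicits.
Arguments Coz : clear implicits.
Arguments C00 : clear implicits.
Arguments C0 : clear implicits.
Arguments CP00 : clear implicits.
Arguments CP0 : clear implicits.

(* [sup set0 = 0], so this is also right on the empty space. *)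
Definition supnorm (R : realType) (T : Type) (f : T -> R) : R :=
  sup (range (fun x => `|f x|)).

(* [A], a set of real functions with the pointwise operations and the supremum
   norm, is a Banach algebra. The ring and module identities hold in [T -> R]. *)
Record banach_algebra (R : realType) (T : Type) (A : set (T -> R)) : Prop :=
  BanachAlgebra {
    banach0 : A 0;
    banachD : forall f g, A f -> A g -> A (f + g);
    banachZ : forall (a : R) f, A f -> A (a *: f);
    banachM : forall f g, A f -> A g -> A (f * g);
    banach_norm0 : forall f, A f -> supnorm f = 0 -> f = 0;
    banach_normD : forall f g, A f -> A g ->
      supnorm (f + g) <= supnorm f + supnorm g;
    banach_normZ : forall (a : R) f, A f -> supnorm (a *: f) = `|a| * supnorm f;
    banach_normM : forall f g, A f -> A g ->
      supnorm (f * g) <= supnorm f * supnorm g;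
    banach_complete : forall u : nat -> T -> R, (forall n, A (u n)) ->
      (forall e : R, 0 < e -> exists N : nat, forall m n : nat,
         (N <= m)%N -> (N <= n)%N -> supnorm (u m - u n) < e) ->
      exists2 f, A f & (fun n => supnorm (u n - f)) @ \oo --> (0 : R)
  }.

Definition isometrically_isomorphic (R : realType) (S T : Type)
    (A : set (S -> R)) (B : set (T -> R)) : Prop :=
  exists phi : (S -> R) -> (T -> R),
    set_bij A B phi /\
    [/\ forall f g, A f -> A g -> phi (f + g) = phi f + phi g,
        forall (a : R) f, A f -> phi (a *: f) = a *: phi f,
        forall f g, A f -> A g -> phi (f * g) = phi f * phi g &
        forall f, A f -> supnorm (phi f) = supnorm f].

(* The Stone-Cech compactification, as the closure of the image of [X] under
   the evaluation map into the product of copies of R indexed by C_b(X). *)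
Section StoneCech.
Variables (R : realType) (X : topologicalType).

Definition cube : topologicalType := {ptws Cb R X -> R}.

Definition ev (x : X) : cube := fun f => set_val f x.

Definition beta : topologicalType := (closure (range ev) : set cube).

Definition iota_beta (x : X) : beta :=
  exist _ (ev x) (mem_set (subset_closure (imageT ev x))).

End StoneCech.

Arguments beta : clear implicits.
Arguments ev R {X} x.
Arguments iota_beta R {X} x.

Lemma subtype_continuous (T U : topologicalType) (A : set U) (g : T -> A) :
  continuous (fun t => set_val (g t)) -> continuous g.
Proof.
move=> cg; apply/continuousP => W [B oB <-].
by move/continuousP: cg; exact.
Qed.

Section StoneCechTheory.
Variable R : realType.

Lemma cube_continuous (X T : topologicalType) (g : T -> cube R X) :
  (forall f, continuous (fun t => g t f)) -> continuous g.
Proof.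
move=> cg t; apply/cvg_sup => f; move: t.
apply/(@continuousP _ (initial_topology (fun q : cube R X => q f))) => A [B oB <-].
by move/continuousP: (cg f); exact.
Qed.

Lemma cube_proj_continuous (X : topologicalType) (f : Cb R X) :
  continuous (fun q : cube R X => q f).
Proof. exact: (@proj_continuous _ (fun=> R) f). Qed.

Lemma cube_hausdorff (X : topologicalType) : hausdorff_space (cube R X).
Proof. by apply: hausdorff_product => _; exact: Rhausdorff. Qed.

Section AnySpace.
Variable X : topologicalType.
Local Notation iota := (@iota_beta R X).

Lemma beta_val_continuous :
  continuous (fun p : beta R X => set_val p : cube R X).
Proof. exact: initial_continuous. Qed.

Lemma ev_continuous : continuous (@ev R X).
Proof.
apply: cube_continuous => -[f fb].
by rewrite /ev /= set_valE /=; case: (set_mem fb).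
Qed.

Lemma iota_beta_continuous : continuous iota.
Proof. by apply: subtype_continuous; exact: ev_continuous. Qed.

Lemma beta_hausdorff : hausdorff_space (beta R X).
Proof.
move=> p q pq; apply: val_inj; apply: (@cube_hausdorff X) => A B pA qB.
have [r [Ar Br]] := pq _ _ (beta_val_continuous pA) (beta_val_continuous qB).
by exists (set_val r).
Qed.

Lemma cube_closure_compact : compact (closure (range (@ev R X))).
Proof.
have bnd (f : Cb R X) : exists M : R, forall x, `|set_val f x| <= M.
  case: f => f fb; rewrite set_valE /=; have [_ /pinfty_ex_gt0 [M _ Mb]] := set_mem fb.
  by exists M => x; exact: Mb.
pose M (f : Cb R X) := projT1 (cid (bnd f)).
have MP f x : `|set_val f x| <= M f by rewrite /M; case: cid.
pose K := [set q : cube R X | forall f, `[- M f, M f]%classic (q f)].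
have cK : compact K.
  apply: (@tychonoff _ (fun=> R) (fun f => `[- M f, M f]%classic)) => f.
  exact: segment_compact.
apply: (subclosed_compact _ cK); first exact: closed_closure.
have clK : closed K by exact: (compact_closed (@cube_hausdorff X)).
rewrite (closure_id K).1//; apply: closureS => _ [x _ <-] f.
by rewrite /= in_itv /= -ler_norml; exact: MP.
Qed.

Lemma subtype_compact (T : topologicalType) (A : set T) :
  compact A -> compact [set: A].
Proof.
move=> cA F PF _.
have [|a [Aa clFa]] := cA (set_val @ F) (fmap_proper_filter _ PF).
  by apply: (@nearW A F (fun a => A (set_val a))) => a; exact: set_valP.
exists (exist _ a (mem_set Aa)); split=> // B C FB [_ [[W oW <-] /= Wa WC]].
have WA : nbhs a W by apply: open_nbhs_nbhs; split.
have FvB : F (fun b : A => (set_val @` B) (set_val b)).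
  by apply: (@filterS A F _ B) => // b Bb; exists b.
have [_ [[b Bb <-] Wb]] := clFa (set_val @` B) W FvB WA.
by exists b; split=> //; exact: WC.
Qed.

Lemma beta_compact : compact [set: beta R X].
Proof. exact: subtype_compact cube_closure_compact. Qed.

Lemma iota_beta_dense : dense (range iota).
Proof.
move=> O [p Op] [W oW WO]; move: Op; rewrite -WO => /= Wp.
have [_ [[x _ <-] Wx]] := set_valP p W (open_nbhs_nbhs (conj oW Wp)).
by exists (iota x); split=> //; exists x.
Qed.

Hypotheses (Xn : normal_space X) (Xh : hausdorff_space X).

Lemma ev_separates (U : set X) (x : X) : open U -> U x ->
  exists2 f : Cb R X, set_val f x = 0 & forall y, ~ U y -> set_val f y = 1.
Proof.
move=> oU Ux.
have cr : completely_regular_space X.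
  by apply: (@normal_completely_regular R) => //; exact: hausdorff_accessible.
have /(@uniform_separatorP _ R) [f [cf f01 f0 f1]] :
    uniform_separator [set x] (~` U).
  by apply: cr; [exact: open_closedC|exact].
have fb : Cb R X f.
  split=> //; exists 1; split=> // M M1 y _ /=.
  have : `[0, 1]%classic (f y) by apply: f01; exists y.
  rewrite /= in_itv /= => /andP[fy0 fy1].
  by rewrite ger0_norm // (le_trans fy1) // ltW.
exists (exist _ f (mem_set fb)); rewrite set_valE /=; first by apply: f0; exists x.
by move=> y Uy; apply: f1; exists y.
Qed.

Lemma iota_beta_inj : injective iota.
Proof.
move=> x y xy; apply: contrapT => xNy.
have oU : open (~` [set y]).
  by apply: closed_openC; apply: accessible_closed_set1; exact: hausdorff_accessible.
have [f fx fy] := ev_separates oU xNy.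
have /(congr1 (fun p => set_val p f)) := xy.
rewrite set_valE /= /ev fx fy; last by move/(_ erefl).
by move/eqP; rewrite eq_sym oner_eq0.
Qed.

Lemma iota_beta_embedding (U : set X) : open U ->
  exists2 V : set (beta R X), open V & iota_beta R @^-1` V = U.
Proof.
move=> oU.
pose V := [set p : beta R X | exists2 f : Cb R X,
  (forall y, ~ U y -> set_val f y = 1) & set_val p f < 1].
exists V.
  have -> : V = \bigcup_(f in [set f : Cb R X | forall y, ~ U y -> set_val f y = 1])
      ((fun p : beta R X => set_val p f) @^-1` [set r : R | r < 1]).
    by apply/seteqP; split=> p [f fU pf]; exists f.
  apply: bigcup_open => f _; apply: open_comp; last exact: open_lt.
  move=> p _; apply: (@continuous_comp _ (cube R X) _ set_val (fun q => q f)).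
    exact: beta_val_continuous.
  exact: cube_proj_continuous.
apply/seteqP; split=> x /=.
  move=> [f fU]; rewrite set_valE /= /ev => fx; apply: contrapT => /fU.
  by move=> fx1; move: fx; rewrite fx1 ltxx.
move=> Ux; have [f fx fU] := ev_separates oU Ux; exists f => //.
by rewrite set_valE /= /ev fx ltr01.
Qed.

End AnySpace.

Lemma beta_extension (X K : topologicalType) (g : X -> K) :
  compact [set: K] -> hausdorff_space K -> continuous g ->
  exists2 G : beta R X -> K, continuous G & forall x, G (iota_beta R x) = g x.
Proof.
move=> cK hK cg; have nK := compact_normal hK cK.
have gP (h : Cb R K) : Cb R X (set_val h \o g).
  case: h => h hb; rewrite set_valE /=; have [ch bh] := set_mem hb; split.
    by move=> x; apply: continuous_comp; [exact: cg|exact: ch].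
  have [M _ Mb] := pinfty_ex_gt0 bh.
  exists M; split; first exact: num_real.
  by move=> r Mr x _ /=; apply: le_trans (Mb _ _) (ltW Mr).
pose gX (h : Cb R K) : Cb R X := SigSub (mem_set (gP h)).
pose Phi (q : cube R X) : cube R K := fun h => q (gX h).
have cPhi : continuous Phi.
  apply: cube_continuous => h.
  exact: (@cube_proj_continuous X (gX h)).
have clK : closed (range (@ev R K)).
  apply: (compact_closed (@cube_hausdorff K)).
  by apply: continuous_compact cK; apply: continuous_subspaceT; exact: ev_continuous.
have PhiK (p : beta R X) : exists k, ev R k = Phi (set_val p).
  suff [k _ <-] : range (@ev R K) (Phi (set_val p)) by exists k.
  apply: clK => W /cPhi /(set_valP p) [_ [[x _ <-] Wx]].
  by exists (Phi (ev R x)); split=> //; exists (g x).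
pose G p := projT1 (cid (PhiK p)).
have GP p : ev R (G p) = Phi (set_val p) by rewrite /G; case: cid.
have ev_inj : injective (@ev R K).
  by move=> x y xy; apply: (iota_beta_inj nK hK); exact: val_inj.
exists G; last by move=> x; apply: ev_inj; rewrite GP.
apply/continuousP => U oU.
have [_ [W oW <-] WU] := @iota_beta_embedding K nK hK _ oU.
have -> : G @^-1` U = (fun p => Phi (set_val p)) @^-1` W.
  by rewrite -WU; apply/seteqP; split=> p /=; rewrite -GP.
apply: open_comp => // p _.
by apply: continuous_comp; [exact: beta_val_continuous|exact: cPhi].
Qed.

End StoneCechTheory.

Definition lambda (R : realType) (P : topologicalType -> Prop)
    (X : topologicalType) : set (beta R X) :=
  \bigcup_(C in [set C | Coz R X C /\ has_null_neighborhood P (closure C)])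
    (closure (iota_beta R @` C))°.

Arguments lambda : clear implicits.

(* Main.v *)
Require Import Defs.
From mathcomp Require Import all_boot all_order all_algebra.
From mathcomp Require Import all_classical all_reals all_analysis.
From mathcomp Require Import lra ring.

(** Call a closed set of X with P a null set. Null sets behave like the compact
    sets of a locally compact space. A null set A has both properties, so it is
    Lindelof; regularity covers it by the interiors of countably many null
    sets, the union of these has P because P passes to countable closed sums,
    and its closure has P because P passes from a dense subspace to a space
    with Q. So every null set has a null neighborhood
    ([closed_property_neighborhood]), and the closure of a countable union of
    null sets is null ([property_closure_bigcup]). Part (1) follows: if f is in
    the first algebra, coz f is the union of its closed superlevel sets, which
    are null, hence supp f is null and has a null neighborhood ([CP0E],
    [CP00E]).

    In part (2), Y = lambda is the union of the closures in beta X of the null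
    sets: a null set A is separated by a Urysohn function from the complement
    of a null neighborhood, which puts the closure of A inside the interior of
    the closure of a null cozero-set ([closure_null_sub_lambda]). Conversely
    compactness puts every compact subset of Y inside the closure of one null
    set ([compact_sub_lambda]). Hence a bounded continuous f lies in the algebra
    exactly when its extension to beta X, restricted to Y, vanishes at infinity,
    and restriction is the isometric isomorphism ([CP0_isometric_C0]). Since
    null sets are stable under closures of countable unions, every
    sigma-compact subset of Y lies in a compact one ([sigma_compact_lambda]);
    this gives both countable compactness and the equality of the functions
    vanishing at infinity with those of compact support. The algebra is complete
    because the support of a uniform limit lies in the closure of the union of
    the supports.

    Uniqueness of Y is a Banach-Stone theorem for two representations of the
    same algebra as C_0(Y) and C_0(Z) ([banach_stone]). Evaluation at a point z
    is a contractive character of the algebra; if its kernel had no common zero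
    in Y, an element of the kernel, positive on a large compact set, would
    produce another one at distance at most 1/2 from an element of value 1
    at z ([character_kernel_point]). So each z names a point of Y and
    conversely, and Urysohn functions make the two maps continuous and inverse
    to each other. *)

Import Order.TTheory GRing.Theory Num.Theory.
Import numFieldNormedType.Exports.
Local Open Scope ring_scope.
Local Open Scope classical_set_scope.
Set Implicit Arguments.
Unset Strict Implicit.
Unset Printing Implicit Defensive.

(** * Compact sets and subspaces *)

(** Passage from local to global, replacing the choice of finite subcovers: if
    J K failed, the sets whose complement in K satisfies J would form a proper
    filter, and its cluster point in K would contradict the local hypothesis. *)
Lemma compact_ideal (T : topologicalType) (K : set T) (J : set T -> Prop) :
  compact K -> J set0 -> (forall A B, J A -> J B -> J (A `|` B)) ->
  (forall A B, A `<=` B -> J B -> J A) ->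
  (forall x, K x -> exists2 U, nbhs x U & J U) -> J K.
Proof.
move=> cK J0 JU JS Jloc; apply: contrapT => nJK.
pose F := [set A : set T | J (K `\` A)].
have FF : ProperFilter F.
  split; first by rewrite /F /= setD0.
  split; first by rewrite /F /= setDT.
    by move=> A B FA FB; rewrite /F /= setDIr; exact: JU.
  by move=> A B AB; apply: JS; exact: setDS.
have FK : F K by rewrite /F /= setDv.
have [x [Kx clx]] := cK F FF FK.
have [U xU JUU] := Jloc x Kx.
have FCU : F (~` U) by apply: JS JUU; rewrite setDE setCK; exact: subIsetr.
by have [z []] := clx _ _ FCU xU.
Qed.

Lemma compact_val_preimage (T : topologicalType) (A K : set T) :
  compact K -> K `<=` A -> compact ((@set_val _ A) @^-1` K).
Proof.
move=> cK KA F PF FK.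
have [a [Ka clFa]] := cK (set_val @ F) (fmap_proper_filter _ PF) FK.
exists (exist _ a (mem_set (KA _ Ka))); split=> // B C FB [_ [[W oW <-] /= Wa WC]].
have WA : nbhs a W by apply: open_nbhs_nbhs; split.
have FvB : F (fun b : A => (set_val @` B) (set_val b)).
  by apply: (@filterS A F _ B) => // b Bb; exists b.
have [_ [[b Bb <-] Wb]] := clFa (set_val @` B) W FvB WA.
by exists b; split=> //; exact: WC.
Qed.

Lemma set_val_continuous (T : topologicalType) (A : set T) :
  continuous (@set_val _ A).
Proof. exact: initial_continuous. Qed.

Lemma closed_val_preimage (T : topologicalType) (A B : set T) :
  closed A -> closed ((@set_val _ B) @^-1` A).
Proof.
move: A; apply/(continuous_closedP (@set_val _ B)); exact: set_val_continuous.
Qed.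

Lemma dense_val_preimage_closure (T : topologicalType) (W : set T) :
  dense ((@set_val _ (closure W)) @^-1` W).
Proof.
move=> O [p Op] [V oV VO]; move: Op; rewrite -VO => /= Vp.
have [x [Wx Vx]] := set_valP p V (open_nbhs_nbhs (conj oV Vp)).
by exists (SigSub (mem_set (subset_closure Wx))).
Qed.

Lemma lindelof_subcover (T : topologicalType) (A : set T) (F : set (set T)) :
  lindelof A -> (forall O, F O -> open O) -> A `<=` \bigcup_(O in F) O ->
  exists G, [/\ G `<=` F, countable G & A `<=` \bigcup_(O in G) O].
Proof.
move=> lA oF AF.
pose t (O : set T) := (@set_val _ A) @^-1` O.
have [||H [HF cH HT]] := lA (t @` F).
- move=> _ [ O FO <-]; apply: open_comp (oF _ FO) => x _.
  exact: set_val_continuous.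
- apply/seteqP; split=> // x _; have [ O FO Ox] := AF _ (set_valP x).
  by exists (t O) => //; exists O.
have pick (U : set A) : exists O, H U -> F O /\ t O = U.
  have [/HF [ O FO UO]|nG] := pselect (H U); first by exists O.
  by exists set0.
pose c U := projT1 (cid (pick U)).
have cP U : H U -> F (c U) /\ t (c U) = U by rewrite /c; case: cid.
exists (c @` H); split.
- by move=> _ [U /cP[FO _] <-].
- exact: sub_countable (card_image_le _ _) _.
- move=> x Ax; have : [set: A] (SigSub (mem_set Ax)) by [].
  rewrite -HT => -[U GU Ux]; exists (c U); first by exists U.
  by move: Ux; rewrite -{1}(cP _ GU).2.
Qed.

(** Hypotheses on P speak of subspaces of a whole space; this turns them into
    statements about nested subsets of X. *)
Lemma homeomorphic_nested (T : topologicalType) (A B : set T) :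
  A `<=` B -> homeomorphic A ((@set_val _ B) @^-1` A).
Proof.
move=> AB.
pose f (a : A) : ((@set_val _ B) @^-1` A) :=
  SigSub (mem_set (set_valP a : ((@set_val _ B) @^-1` A)
    (SigSub (mem_set (AB _ (set_valP a)))))).
pose g (b : ((@set_val _ B) @^-1` A)) : A :=
  SigSub (mem_set (set_valP b : A (set_val (set_val b)))).
exists f, g; split.
- apply: subtype_continuous; apply: subtype_continuous.
  exact: set_val_continuous.
- apply: subtype_continuous => x.
  apply: (@continuous_comp _ B _ set_val set_val); exact: set_val_continuous.
- by move=> a; apply: val_inj.
- by move=> b; apply: val_inj; apply: val_inj.
Qed.

(** * Subsets with a closed hereditary property *)

Section ClosedSums.
Variable P : topologicalType -> Prop.
Hypothesis P_top : topological_property P.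
Hypothesis P_closed : closed_hereditary P.

Lemma property_nested (T : topologicalType) (A B : set T) :
  A `<=` B -> P ((@set_val _ B) @^-1` A) <-> P A.
Proof.
move=> AB; have [f [g [cf cg fK gK]]] := homeomorphic_nested AB.
by split; apply: P_top; [exists g, f|exists f, g].
Qed.

Lemma property_closedS (T : topologicalType) (A B : set T) :
  closed A -> A `<=` B -> P B -> P A.
Proof.
move=> cA AB PB; apply/(property_nested AB); apply: P_closed => //.
exact: closed_val_preimage.
Qed.

Hypothesis P_sums : preserved_under_countable_closed_sums P.

Lemma property_set0 (T : topologicalType) : P (set0 : set T).
Proof.
apply: (P_sums (F := set0)) => //.
by rewrite bigcup_set0; apply/esym/seteqP; split=> // x _; case: (set_valP x).
Qed.

Lemma property_bigcup (T : topologicalType) (F : set (set T)) :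
  countable F -> (forall A, F A -> closed A /\ P A) -> P (\bigcup_(A in F) A).
Proof.
move=> cF FP; set W := \bigcup_(A in F) A.
apply: (P_sums (F := [set (@set_val _ W) @^-1` A | A in F])).
- exact: sub_countable (card_image_le _ _) _.
- move=> _ [A FA <-]; have [clA PA] := FP A FA; split.
    exact: closed_val_preimage.
  by apply/property_nested => //; exact: bigcup_sup.
- apply/seteqP; split=> // x _; have [A FA Ax] := set_valP x.
  by exists ((@set_val _ W) @^-1` A) => //; exists A.
Qed.

End ClosedSums.

(** * Bounded continuous functions and the supremum norm *)

Section SupNorm.
Variables (R : realType) (T : Type).
Implicit Types f g : T -> R.

Lemma bounded_funP f : bounded_fun f <-> exists M, forall x, `|f x| <= M.
Proof.
split=> [/pinfty_ex_gt0 [M _ Mb]|[M Mb]]; first by exists M => x; exact: Mb.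
exists M; split; first exact: num_real.
by move=> r Mr x _ /=; exact: le_trans (Mb x) (ltW Mr).
Qed.

Lemma supnorm_ubound f x : bounded_fun f -> `|f x| <= supnorm f.
Proof.
move=> /bounded_funP [M Mb]; apply: ub_le_sup; last by exists x.
by exists M => _ [y _ <-].
Qed.

Lemma supnorm_le f M : 0 <= M -> (forall x, `|f x| <= M) -> supnorm f <= M.
Proof.
move=> M0 Mb; rewrite /supnorm.
have [->|/set0P E0] := eqVneq (range (fun x => `|f x|)) set0; first by rewrite sup0.
by apply: ge_sup => // _ [x _ <-].
Qed.

Lemma supnorm_ge0 f : 0 <= supnorm f.
Proof.
rewrite /supnorm; have [->|/set0P [_ [x _ _]]] :=
  eqVneq (range (fun x => `|f x|)) set0; first by rewrite sup0.
have [bf|nbf] := pselect (has_sup (range (fun x => `|f x|)));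
  last by rewrite sup_out.
by apply: le_trans (normr_ge0 (f x)) _; apply: ub_le_sup; [exact: bf.2|exists x].
Qed.

Lemma supnormZ (a : R) f : bounded_fun f -> supnorm (a *: f) = `|a| * supnorm f.
Proof.
move=> bf; apply/eqP; rewrite eq_le; apply/andP; split.
  apply: supnorm_le => [|x]; first by rewrite mulr_ge0 // supnorm_ge0.
  by rewrite normrM ler_wpM2l // supnorm_ubound.
have [->|a0] := eqVneq a 0; first by rewrite normr0 mul0r supnorm_ge0.
rewrite -ler_pdivlMl ?normr_gt0 //; apply: supnorm_le => [|x].
  by rewrite mulr_ge0 ?supnorm_ge0 // invr_ge0.
rewrite ler_pdivlMl ?normr_gt0 // -normrM.
apply: (@supnorm_ubound (a *: f)); have [M Mb] := (bounded_funP f).1 bf.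
by apply/bounded_funP; exists (`|a| * M) => y; rewrite normrM ler_wpM2l.
Qed.

End SupNorm.

Section BoundedContinuous.
Variables (R : realType) (X : topologicalType).
Implicit Types f g : X -> R.

Lemma CbD f g : Cb R X f -> Cb R X g -> Cb R X (f + g).
Proof.
move=> [cf /bounded_funP [M Mb]] [cg /bounded_funP [N Nb]]; split.
  by move=> x; apply: cvgD; [exact: cf|exact: cg].
apply/bounded_funP; exists (M + N) => x.
by apply: le_trans (ler_normD _ _) _; exact: lerD.
Qed.

Lemma CbM f g : Cb R X f -> Cb R X g -> Cb R X (f * g).
Proof.
move=> [cf /bounded_funP [M Mb]] [cg /bounded_funP [N Nb]]; split.
  by move=> x; apply: cvgM; [exact: cf|exact: cg].
by apply/bounded_funP; exists (M * N) => x; rewrite normrM ler_pM.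
Qed.

Lemma CbZ (a : R) f : Cb R X f -> Cb R X (a *: f).
Proof.
move=> [cf /bounded_funP [M Mb]]; split.
  by move=> x; apply: cvgM; [exact: cvg_cst|exact: cf].
by apply/bounded_funP; exists (`|a| * M) => x; rewrite normrM ler_wpM2l.
Qed.

Lemma Cb0 : Cb R X 0.
Proof.
split; first by move=> x; exact: cvg_cst.
by apply/bounded_funP; exists 0 => x; rewrite normr0.
Qed.

Lemma coz0 : coz (0 : X -> R) = set0.
Proof. by apply/seteqP; split=> x //=; apply. Qed.

Lemma cozD f g : coz (f + g) `<=` coz f `|` coz g.
Proof.
move=> x /= fg; apply: contrapT => /not_orP [/contrapT fx /contrapT gx].
by apply: fg; change (f x + g x = 0); rewrite fx gx addr0.
Qed.

Lemma cozZ (a : R) f : coz (a *: f) `<=` coz f.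
Proof.
by move=> x /= afx fx; apply: afx; change (a * f x = 0); rewrite fx mulr0.
Qed.

Lemma cozM f g : coz (f * g) `<=` coz f.
Proof.
by move=> x /= fgx fx; apply: fgx; change (f x * g x = 0); rewrite fx mul0r.
Qed.

Lemma closed_superlevel (f : X -> R) n : continuous f -> closed (superlevel f n).
Proof.
move=> cf; apply: (@preimage_closed _ _ (fun x => `|f x|) [set r | n%:R^-1 <= r]).
  by move=> x _; apply: continuous_comp; [exact: cf|exact: norm_continuous].
exact: closed_ge.
Qed.

Lemma coz_bigcup_superlevel (f : X -> R) :
  coz f = \bigcup_n superlevel f n.+1.
Proof.
apply/seteqP; split=> x.
  move=> /eqP; rewrite -normr_gt0 => fx0.
  have [n nf] := ltr_add_invr (fx0).
  by exists n => //; rewrite /superlevel /= ltW // -[X in X < _]add0r.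
move=> [n _ nf] /= fx0; move: nf; rewrite /superlevel /= fx0 normr0.
by rewrite leNgt invr_gt0 ltr0n.
Qed.

Lemma superlevel_coz f n : (0 < n)%N -> superlevel f n `<=` coz f.
Proof.
move=> n0 x /= nf fx0; move: nf; rewrite /superlevel /= fx0 normr0.
by rewrite leNgt invr_gt0 ltr0n n0.
Qed.

Definition uniform_limit (u : nat -> X -> R) f := forall e : R, 0 < e ->
  exists N, forall n x, (N <= n)%N -> `|u n x - f x| <= e.

Lemma uniform_limit_Cb u f :
  (forall n, Cb R X (u n)) -> uniform_limit u f -> Cb R X f.
Proof.
move=> ub uf; split.
  move=> x; apply/cvgrPdist_lt => e e0.
  have [N Nf] := uf (e / 4) (divr_gt0 e0 (ltr0n _ 4)).
  have /cvgrPdist_lt/(_ _ (divr_gt0 e0 (ltr0n _ 4))) := (ub N).1 x.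
  apply: filterS => y /= xy; have := Nf N x (leqnn _); have := Nf N y (leqnn _).
  rewrite !ler_norml !ltr_norml in xy *; move=> /andP[? ?] /andP[? ?].
  by move: xy => /andP[? ?]; apply/andP; split; lra.
have [N Nf] := uf 1 ltr01; have [M Mb] := (bounded_funP _).1 (ub N).2.
apply/bounded_funP; exists (M + 1) => x; have := Nf N x (leqnn _); have := Mb x.
by rewrite !ler_norml => /andP[? ?] /andP[? ?]; apply/andP; split; lra.
Qed.

(** This inclusion keeps uniform limits inside an algebra defined by a condition
    on supports that is stable under closures of countable unions. *)
Lemma uniform_limit_coz u f :
  uniform_limit u f -> coz f `<=` \bigcup_n coz (u n).
Proof.
move=> uf x /= fx; apply: contrapT => nu; apply: fx.
have ux n : u n x = 0 by apply: contrapT => ux; apply: nu; exists n.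
apply/eqP; rewrite -normr_le0; apply/ler_addgt0Pl => e e0.
by have [N /(_ N x (leqnn _))] := uf e e0; rewrite ux sub0r normrN addr0.
Qed.

(** The limit is taken pointwise; the sup-norm Cauchy condition makes the
    pointwise estimates uniform. *)
Lemma supnorm_cauchy_uniform_limit (u : nat -> X -> R) :
  (forall n, Cb R X (u n)) ->
  (forall e : R, 0 < e -> exists N : nat, forall m n : nat,
     (N <= m)%N -> (N <= n)%N -> supnorm (u m - u n) < e) ->
  exists f, uniform_limit u f.
Proof.
move=> ub uC.
have uCx e : 0 < e -> exists N : nat, forall m n x,
    (N <= m)%N -> (N <= n)%N -> `|u m x - u n x| <= e.
  move=> /uC [N NC]; exists N => m n x Nm Nn; apply: le_trans (ltW (NC m n Nm Nn)).
  apply: (@supnorm_ubound _ _ (u m - u n)).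
  by rewrite -scaleN1r; exact: (CbD (ub m) (CbZ (-1) (ub n))).2.
have cu x : cvg (u n x @[n --> \oo]).
  apply/cauchy_cvgP; apply: cauchy_exP => e e0.
  have [N NC] := uCx (e / 2) (divr_gt0 e0 (ltr0n _ 2)).
  exists (u N x); exists N => // n /= Nn; rewrite /ball /=.
  by apply: le_lt_trans (NC _ _ _ (leqnn N) Nn) _;
    rewrite gtr_pMr // invf_lt1 ?ltr1n.
exists (fun x => lim (u n x @[n --> \oo])) => e e0.
have [N NC] := uCx e e0; exists N => n x Nn; apply/ler_addgt0Pr => d d0.
have /cvgrPdist_le/(_ _ d0) [M _ Md] := cu x.
have := Md (maxn M N) (leq_maxl _ _); have := NC n (maxn M N) x Nn (leq_maxr _ _).
by rewrite !ler_norml => /andP[? ?] /andP[? ?]; apply/andP; split; lra.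
Qed.

Lemma Cb_subalgebra_banach (A : set (X -> R)) :
  A `<=` Cb R X -> A 0 -> (forall f g, A f -> A g -> A (f + g)) ->
  (forall (a : R) f, A f -> A (a *: f)) ->
  (forall f g, A f -> A g -> A (f * g)) ->
  (forall u f, (forall n, A (u n)) -> uniform_limit u f -> A f) ->
  banach_algebra A.
Proof.
move=> Ab A0 AD AZ AM Al; split=> //.
- move=> f Af f0; apply/funext => x; apply/eqP; rewrite -normr_le0 -f0.
  by apply: supnorm_ubound; exact: (Ab _ Af).2.
- move=> f g /Ab [_ bf] /Ab [_ bg]; apply: supnorm_le => [|x].
    by rewrite addr_ge0 // supnorm_ge0.
  by apply: le_trans (ler_normD _ _) _; apply: lerD; exact: supnorm_ubound.
- by move=> a f /Ab [_ bf]; exact: supnormZ.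
- move=> f g /Ab [_ bf] /Ab [_ bg]; apply: supnorm_le => [|x].
    by rewrite mulr_ge0 // supnorm_ge0.
  by rewrite normrM ler_pM // supnorm_ubound.
- move=> u Au /(supnorm_cauchy_uniform_limit (fun n => Ab _ (Au n))) [f uf].
  exists f; first exact: Al Au uf.
  apply/cvgrPdist_le => e e0; have [N Nf] := uf e e0; exists N => // n /= Nn.
  rewrite sub0r normrN ger0_norm ?supnorm_ge0 //.
  by apply: supnorm_le => [|x]; [exact: ltW|exact: Nf].
Qed.

End BoundedContinuous.

(** * Extension to the Stone-Cech compactification *)

Lemma open_closure_dense (T : topologicalType) (O D : set T) :
  open O -> dense D -> O `<=` closure (O `&` D).
Proof.
move=> oO dD p Op B pB.
have [|x [[Ox Bx] Dx]] := dD (O `&` B°) _ (openI oO (open_interior B)).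
  by exists p; split.
by exists x; split; [split|exact: interior_subset].
Qed.

Lemma open_neq0 (T : topologicalType) (R : realType) (u : T -> R) :
  continuous u -> open [set x | u x != 0].
Proof.
move=> cu; apply: (@open_comp _ _ u [set r | r != 0]); last exact: open_neq.
by move=> x _; exact: cu.
Qed.

Lemma dense_continuous_eq (T : topologicalType) (R : realType) (D : set T)
    (u v : T -> R) :
  dense D -> continuous u -> continuous v -> (forall x, D x -> u x = v x) ->
  u = v.
Proof.
move=> dD cu cv uv.
have cw : continuous (fun x => u x - v x).
  by move=> x; apply: cvgB; [exact: cu|exact: cv].
apply/funext => x; apply/eqP; rewrite -subr_eq0; apply: contrapT => /negP xn.
have oW : open [set x | u x - v x != 0].
  exact: (open_neq0 cw).
have [|z [/= zn Dz]] := dD _ _ oW; first by exists x.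
by move: zn; rewrite uv // subrr eqxx.
Qed.

Lemma continuous_closure_closed (T U : topologicalType) (u : T -> U)
    (A : set T) (D : set U) :
  continuous u -> closed D -> (forall x, A x -> D (u x)) ->
  forall x, closure A x -> D (u x).
Proof.
move=> cu cD AD x; rewrite -[D (u x)]/((u @^-1` D) x).
rewrite (closure_id (u @^-1` D)).1; first by apply: closureS.
exact: (continuous_closedP u).1.
Qed.

Lemma normal_Urysohn (R : realType) (X : topologicalType) (A B : set X) :
  normal_space X -> closed A -> closed B -> A `&` B = set0 ->
  exists f : X -> R, [/\ Cb R X f, forall x, A x -> f x = 1 &
    forall x, B x -> f x = 0].
Proof.
move=> nX cA cB AB; have BA : B `&` A = set0 by rewrite setIC.
have /(@uniform_separatorP _ R) [f [cf f01 fB fA]] :=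
  normal_uniform_separator nX cB cA BA.
exists f; split; first split=> //.
- apply/bounded_funP; exists 1 => x.
  have : `[0, 1]%classic (f x) by apply: f01; exists x.
  by rewrite /= in_itv /= => /andP[fx0 fx1]; rewrite ger0_norm.
- by move=> x Ax; apply: fA; exists x.
- by move=> x Bx; apply: fB; exists x.
Qed.

Section BetaExtension.
Variables (R : realType) (X : topologicalType).
Local Notation iota := (@iota_beta R X).

(** The points of the compactification are functionals on the bounded continuous
    functions, so extending f is evaluation at f; a function outside [Cb] gets
    the junk value 0. *)
Definition beta_ext (f : X -> R) (p : beta R X) : R :=
  if pselect (Cb R X f) is left fb then set_val p (SigSub (mem_set fb)) else 0.

Lemma beta_ext_continuous f : continuous (beta_ext f).
Proof.
rewrite /beta_ext; case: pselect => [fb|_] p;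
  last exact: cst_continuous.
apply: (@continuous_comp _ (cube R X) _ set_val (fun q => q (SigSub (mem_set fb)))).
  exact: beta_val_continuous.
exact: cube_proj_continuous.
Qed.

Lemma beta_ext_iota f x : Cb R X f -> beta_ext f (iota x) = f x.
Proof. by rewrite /beta_ext; case: pselect. Qed.

Lemma beta_ext_closure f (A : set X) (D : set R) p :
  Cb R X f -> closed D -> (forall x, A x -> D (f x)) ->
  closure (iota @` A) p -> D (beta_ext f p).
Proof.
move=> fb cD AD; apply: continuous_closure_closed => //.
  exact: beta_ext_continuous.
by move=> _ [x Ax <-]; rewrite beta_ext_iota //; exact: AD.
Qed.

(** The nonvanishing set of the extension is open and X is dense in it, so each
    of its points is near coz f. *)
Lemma beta_ext_neq0_interior f p : Cb R X f -> beta_ext f p != 0 ->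
  (closure (iota @` coz f))° p.
Proof.
move=> fb fp; pose O := [set q | beta_ext f q != 0].
have oO : open O by apply: open_neq0; exact: beta_ext_continuous.
apply: (@filterS _ _ _ O); last exact: open_nbhs_nbhs.
apply: subset_trans (open_closure_dense oO (@iota_beta_dense R X)) _.
apply: closureS => _ [/[swap] [[x _ <-]]]; rewrite /O /= beta_ext_iota // => fx.
by exists x => //; apply/eqP.
Qed.

Lemma beta_ext_norm_le f p : Cb R X f -> `|beta_ext f p| <= supnorm f.
Proof.
move=> fb; have pD : closure (iota @` setT) p.
  by have := open_closure_dense openT (@iota_beta_dense R X) (I : setT p);
    rewrite setTI.
apply: (@beta_ext_closure f setT [set r | `|r| <= supnorm f]) pD => //.
  apply: (@preimage_closed _ _ (@Num.norm R R) [set r | r <= supnorm f]).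
    by move=> r _; exact: norm_continuous.
  exact: closed_le.
by move=> x _ /=; apply: supnorm_ubound; exact: fb.2.
Qed.

Hypotheses (Xn : normal_space X) (Xh : hausdorff_space X).

(** This holds because X embeds in its compactification; it recovers null sets
    of X from closures in beta X. *)
Lemma closure_iotaE (A : set X) x : closure (iota @` A) (iota x) -> closure A x.
Proof.
move=> clx; apply: contrapT => nAx.
have [V oV VE] := @iota_beta_embedding R X Xn Xh _
  (closed_openC (@closed_closure _ A)).
have [|_ [[a Aa <-] Va]] := clx V.
  by apply: open_nbhs_nbhs; split=> //; rewrite -[V _]/((iota @^-1` V) x) VE.
have : (iota @^-1` V) a by [].
by rewrite VE; apply; exact: subset_closure.
Qed.

End BetaExtension.


(** * Null sets *)

Section NullSets.
Variables P Q : topologicalType -> Prop.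
Hypothesis P_top : topological_property P.
Hypothesis P_closed : closed_hereditary P.
Hypothesis Q_closed : closed_hereditary Q.
Hypothesis PQ_lindelof : forall T : topologicalType, P T -> Q T -> lindelof T.
Hypothesis P_sums : preserved_under_countable_closed_sums P.
Hypothesis P_dense : forall T : topologicalType, Q T ->
  (exists2 D : set T, dense D & P D) -> P T.
Variable X : topologicalType.
Hypothesis X_loc : locally_property P X.
Hypothesis X_Q : Q X.

(** The countable union has P as a countable closed sum, and it is dense in its
    closure, which has Q. *)
Lemma property_closure_bigcup (F : set (set X)) :
  countable F -> (forall A, F A -> closed A /\ P A) ->
  P (closure (\bigcup_(A in F) A)).
Proof.
move=> cF FP; set W := \bigcup_(A in F) A; apply: P_dense.
  by apply: Q_closed => //; exact: closed_closure.
exists ((@set_val _ (closure W)) @^-1` W).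
  exact: dense_val_preimage_closure.
apply/(property_nested P_top); first exact: subset_closure.
exact: property_bigcup.
Qed.

Lemma closed_propertyU (A B : set X) :
  closed A -> P A -> closed B -> P B -> closed (A `|` B) /\ P (A `|` B).
Proof.
move=> cA PA cB PB; split; first exact: closedU.
rewrite -bigcup2E; have -> : \bigcup_i bigcup2 A B i = \bigcup_(C in [set A; B]) C.
  rewrite bigcup2E; apply/seteqP; split=> [x [?|?]|x [C [->|->] ?]].
  - by exists A => //; left.
  - by exists B => //; right.
  - by left.
  - by right.
apply: property_bigcup => //; last by move=> C [->|->].
by apply: finite_set_countable; exact: finite_set2.
Qed.

Section RegularNullSets.
Hypothesis X_reg : regular_space X.

Lemma closed_property_nbhs (x : X) :
  exists2 V, nbhs x V & closed V /\ P V.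
Proof.
have [U xU PU] := X_loc x; have [V xV VU] := X_reg xU.
exists (closure V); first by apply: filterS xV; exact: subset_closure.
have cV : closed (closure V) by exact: closed_closure.
by split=> //; exact: property_closedS VU PU.
Qed.

(** The Lindelof property selects countably many closed sets with P whose
    interiors cover A; the closure of their union is the neighborhood. *)
Lemma closed_property_neighborhood (A : set X) : closed A -> P A ->
  exists B, [/\ closed B, P B & A `<=` B°].
Proof.
move=> cA PA.
have lA : lindelof A by apply: PQ_lindelof => //; exact: Q_closed.
pose F := [set O | exists V : set X, [/\ closed V, P V & V° = O]].
have [||G [GF cG AG]] := lindelof_subcover (F := F) lA.
- by move=> _ [V [_ _ <-]]; exact: open_interior.
- move=> x _; have [V xV [cV PV]] := closed_property_nbhs x.
  by exists V°; [exists V|].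
have pick (O : set X) : exists V : set X, G O -> [/\ closed V, P V & V° = O].
  have [/GF [V VP]|nG] := pselect (G O); first by exists V.
  by exists set0.
pose c O := projT1 (cid (pick O)).
have cP O : G O -> [/\ closed (c O), P (c O) & (c O)° = O].
  by rewrite /c; case: cid.
exists (closure (\bigcup_(V in c @` G) V)); split; first exact: closed_closure.
  apply: property_closure_bigcup; first exact: sub_countable (card_image_le _ _) _.
  by move=> _ [ O /cP[? ? _] <-].
move=> x /AG [ O GO]; have [_ _ <-] := cP O GO; apply: interiorS.
by move=> y Oy; apply: subset_closure; exists (c O) => //; exists O.
Qed.

(** Since null sets have null neighborhoods, asking for a null neighborhood is
    no more than asking for a null closure. *)
Lemma has_null_neighborhoodP (A : set X) :
  has_null_neighborhood P A <-> P (closure A).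
Proof.
split=> [[U AU PU]|PA].
  apply: property_closedS PU => //; first exact: closed_closure.
  by apply: closureS; apply: subset_trans AU _; exact: interior_subset.
have [|B [cB PB AB]] := closed_property_neighborhood _ PA.
  exact: closed_closure.
exists B; first exact: subset_trans (@subset_closure _ A) AB.
by rewrite /null -(closure_id B).1.
Qed.

Variable R : realType.

(** The cozero-set is the countable union of the superlevel sets, each of which
    is closed and null. *)
Lemma CP0_supp (f : X -> R) : CP0 R X P f -> P (supp f).
Proof.
move=> [[cf _] fP].
rewrite /supp coz_bigcup_superlevel.
rewrite -(bigcup_image setT (fun n => superlevel f n.+1) id).
apply: property_closure_bigcup; first exact: sub_countable (card_image_le _ _) _.
move=> _ [n _ <-]; have cs : closed (superlevel f n.+1) by exact: closed_superlevel.
split=> //.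
rewrite (closure_id (superlevel f n.+1)).1 //.
by apply/has_null_neighborhoodP; exact: fP.
Qed.

Lemma CP0E : CP0 R X P = [set f | Cb R X f /\ P (supp f)].
Proof.
apply/seteqP; split=> f.
  by move=> fP; split; [exact: fP.1|exact: CP0_supp].
move=> [fb Pf]; split=> // n n0; apply/has_null_neighborhoodP.
apply: property_closedS Pf => //; first exact: closed_closure.
by apply: closureS; exact: superlevel_coz.
Qed.

Lemma CP00E : CP00 R X P = [set f | Cb R X f /\ P (supp f)].
Proof.
have suppE (f : X -> R) : has_null_neighborhood P (supp f) <-> P (supp f).
  rewrite has_null_neighborhoodP -(closure_id (supp f)).1 //.
  exact: closed_closure.
by apply/seteqP; split=> f [? /suppE].
Qed.

End RegularNullSets.

(** * The space of points near null cozero-sets *)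

Section NormalNullSets.
Variable R : realType.
Hypotheses (Xn : normal_space X) (Xh : hausdorff_space X).
Local Notation iota := (@iota_beta R X).
Local Notation Y := (lambda R P X).

Let X_reg : regular_space X.
Proof.
apply: (@completely_regular_regular R); apply: (@normal_completely_regular R) => //.
exact: hausdorff_accessible.
Qed.

Lemma lambda_open : open Y.
Proof. by apply: bigcup_open => C _; exact: open_interior. Qed.

(** A Urysohn function equal to 1 on A and to 0 off a null neighborhood of A has
    a null cozero-set, and its extension is still 1 on the closure of A in
    beta X. *)
Lemma closure_null_sub_lambda (A : set X) : closed A -> P A ->
  closure (iota @` A) `<=` Y.
Proof.
move=> cA PA p Ap.
have [B [cB PB AB]] := closed_property_neighborhood X_reg cA PA.
have [|f [fb fA fB]] :=
    normal_Urysohn R Xn cA (open_closedC (open_interior B)).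
  by apply/seteqP; split=> // x [/AB].
have fp : beta_ext f p = 1.
  by apply: (@beta_ext_closure _ _ f A [set 1]) Ap => //; exact: closed_eq.
exists (coz f); last by apply: beta_ext_neq0_interior; rewrite ?fp ?oner_eq0.
split; first by exists f => //; exact: fb.1.
apply/(has_null_neighborhoodP X_reg).
apply: (property_closedS P_top P_closed _ _ PB); first exact: closed_closure.
rewrite [X in _ `<=` X](closure_id B).1 //.
rewrite -(closure_id (closure _)).1; last exact: closed_closure.
apply: closureS => x fx; apply: interior_subset; apply: contrapT => /fB fx0.
by apply: fx.
Qed.

Lemma iota_lambda x : Y (iota x).
Proof.
have [V xV [cV PV]] := closed_property_nbhs X_reg x.
apply: (closure_null_sub_lambda cV PV); apply: subset_closure.
by exists x => //; exact: nbhs_singleton.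
Qed.

(** By definition each point of lambda has a neighborhood inside the closure of
    a null set, and null sets are stable under finite unions. *)
Lemma compact_sub_lambda (K : set (beta R X)) : compact K -> K `<=` Y ->
  exists A : set X, [/\ closed A, P A & K `<=` closure (iota @` A)].
Proof.
move=> cK KY.
apply: (compact_ideal (J := fun K => exists A : set X,
  [/\ closed A, P A & K `<=` closure (iota @` A)])) => //.
- by exists set0; split=> //; [exact: closed0|exact: property_set0].
- move=> K1 K2 [A1 [cA1 PA1 KA1]] [A2 [cA2 PA2 KA2]]; exists (A1 `|` A2).
  have [cA PA] := closed_propertyU cA1 PA1 cA2 PA2; split=> //.
  by rewrite image_setU closureU; exact: setUSS.
- move=> K1 K2 K12 [A [cA PA KA]]; exists A; split=> //.
  exact: subset_trans KA.
- move=> p /KY [C [_ nC] pC]; exists (closure (iota @` C)) => //.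
  exists (closure C); split; first exact: closed_closure.
    move: nC => /(has_null_neighborhoodP X_reg).
    by rewrite -(closure_id (closure C)).1 //; exact: closed_closure.
  by apply: closureS; apply: image_subset; exact: subset_closure.
Qed.

Lemma compact_lambda_null_closure (A : set X) : closed A -> P A ->
  compact ((@set_val _ Y) @^-1` closure (iota @` A)).
Proof.
move=> cA PA; apply: compact_val_preimage; last exact: closure_null_sub_lambda.
by apply: (subclosed_compact _ (@beta_compact R X)) => //; exact: closed_closure.
Qed.

Lemma lambda_hausdorff : hausdorff_space Y.
Proof.
move=> p q pq; apply: val_inj; apply: (@beta_hausdorff R X) => A B pA qB.
have [r [Ar Br]] := pq _ _ (@set_val_continuous _ Y p _ pA)
  (@set_val_continuous _ Y q _ qB).
by exists (set_val r).
Qed.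

Lemma lambda_locally_compact : locally_compact [set: Y].
Proof.
move=> p _; have [C [_ nC] pC] := set_valP p.
have PC : P (closure C).
  move: nC => /(has_null_neighborhoodP X_reg).
  by rewrite -(closure_id (closure C)).1 //; exact: closed_closure.
have cK := compact_lambda_null_closure (@closed_closure _ C) PC.
exists ((@set_val _ Y) @^-1` closure (iota @` closure C)).
  suff pK : nbhs p ((@set_val _ Y) @^-1` closure (iota @` closure C)).
    by apply: (@filterS _ (nbhs p) _ _ _ _ pK) => q Cq _.
  apply: (@set_val_continuous _ Y); apply: filterS pC.
  by apply: closureS; apply: image_subset; exact: subset_closure.
by split=> //; apply: compact_closed cK; exact: lambda_hausdorff.
Qed.

(** Each compact set lies in the closure of a null set, and the closure of the
    union of countably many null sets is again null. *)
Lemma sigma_compact_lambda (K : nat -> set Y) : (forall n, compact (K n)) ->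
  exists2 L : set Y, compact L & \bigcup_n K n `<=` L.
Proof.
move=> cK.
have pick n : exists A : set X,
    [/\ closed A, P A & (@set_val _ Y) @` K n `<=` closure (iota @` A)].
  apply: compact_sub_lambda; last by move=> _ [p _ <-]; exact: set_valP.
  apply: continuous_compact (cK n); apply: continuous_subspaceT.
  exact: set_val_continuous.
pose A n := projT1 (cid (pick n)).
have AP n : [/\ closed (A n), P (A n) &
    (@set_val _ Y) @` K n `<=` closure (iota @` A n)] by rewrite /A; case: cid.
pose B := closure (\bigcup_(C in range A) C).
exists ((@set_val _ Y) @^-1` closure (iota @` B)).
  apply: compact_lambda_null_closure; first exact: closed_closure.
  apply: property_closure_bigcup; first exact: sub_countable (card_image_le _ _) _.
  by move=> _ [n _ <-]; have [] := AP n.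
move=> p [n _ Kp]; have [_ _ KA] := AP n.
apply: closureS (KA _ (imageP _ Kp)); apply: image_subset => x Ax.
by apply: subset_closure; exists (A n).
Qed.

(** If no finite subfamily covers, choose a point outside each of an increasing
    sequence of finite subfamilies exhausting the cover. The chosen points lie
    in one compact set, which is covered by one of these subfamilies. *)
Lemma lambda_countably_compact : countably_compact Y.
Proof.
move=> F /countable_injP [f finj] oF FY; apply: contrapT => nG.
pose G n := F `&` [set A | (f A < n)%N].
have finG n : finite_set (G n).
  have /inj_card_eq/eq_finite_set <- : {in G n &, injective f}.
    by move=> A B; rewrite !inE => -[FA _] [FB _]; apply: finj; rewrite inE.
  by apply: sub_finite_set (finite_II n) => _ [A [_ fA] <-].
have pick n : exists p : Y, ~ (\bigcup_(A in G n) A) p.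
  apply: contrapT => /forallNP np; apply: nG; exists (G n); split=> //.
    by move=> A [].
  by apply/seteqP; split=> // p _; exact: contrapT (np p).
pose p n := projT1 (cid (pick n)).
have pP n : ~ (\bigcup_(A in G n) A) (p n) by rewrite /p; case: cid.
have [|L cL pL] := sigma_compact_lambda (K := fun n => [set p n]).
  by move=> n; exact: compact_set1.
have [n LG] : exists n, L `<=` \bigcup_(A in G n) A.
  apply: (compact_ideal (J := fun L => exists n, L `<=` \bigcup_(A in G n) A)) => //.
  - by exists 0%N.
  - move=> A B [m Am] [n Bn]; exists (maxn m n).
    by move=> x [/Am|/Bn] [C [FC fC] Cx]; exists C => //; split=> //=;
      apply: leq_trans fC _; [exact: leq_maxl|exact: leq_maxr].
  - by move=> A B AB [n Bn]; exists n; exact: subset_trans Bn.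
  - move=> x _; have : [set: Y] x by [].
    rewrite -FY => -[A FA Ax]; exists A.
      by apply: open_nbhs_nbhs; split=> //; exact: oF.
    by exists (f A).+1 => y Ay; exists A => //; split=> /=.
by apply: (pP n); apply: LG; apply: pL; exists n.
Qed.

(** The cozero-set of a function vanishing at infinity is sigma-compact. *)
Lemma C0_lambda : C0 R Y = C00 R Y.
Proof.
apply/seteqP; split=> g [gb cg]; split=> //; last first.
  move=> n n0; apply: (subclosed_compact _ cg); first exact: closed_superlevel gb.1.
  exact: subset_trans (superlevel_coz n0) (@subset_closure _ _).
have [|L cL gL] := sigma_compact_lambda (K := fun n => superlevel g n.+1).
  by move=> n; exact: cg.
have cloL : closed L by apply: compact_closed cL; exact: lambda_hausdorff.
apply: (subclosed_compact _ cL); first exact: closed_closure.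
by rewrite (closure_id L).1 //; apply: closureS; rewrite coz_bigcup_superlevel.
Qed.

Definition iota_Y (x : X) : Y := SigSub (mem_set (iota_lambda x)).

Lemma iota_Y_dense : dense (range iota_Y).
Proof.
move=> O [p Op] [W oW WO]; move: Op; rewrite -WO => /= Wp.
have [|q [[Wq Yq] [x _ xq]]] :=
    @iota_beta_dense R X (W `&` Y) _ (openI oW lambda_open).
  by exists (set_val p); split=> //; exact: set_valP.
by exists (iota_Y x); split; [rewrite /= set_valE /= xq|exists x].
Qed.

Definition lambda_ext (f : X -> R) (p : Y) : R := beta_ext f (set_val p).

Lemma lambda_ext_continuous f : continuous (lambda_ext f).
Proof.
move=> p; apply: continuous_comp; first exact: set_val_continuous.
exact: beta_ext_continuous.
Qed.

Lemma lambda_ext_iota f x : Cb R X f -> lambda_ext f (iota_Y x) = f x.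
Proof. exact: beta_ext_iota. Qed.

Lemma lambda_ext_unique f (g : Y -> R) : Cb R X f -> continuous g ->
  (forall x, g (iota_Y x) = f x) -> lambda_ext f = g.
Proof.
move=> fb cg gf; apply: (dense_continuous_eq iota_Y_dense) => //.
  exact: lambda_ext_continuous.
by move=> _ [x _ <-]; rewrite lambda_ext_iota.
Qed.

Lemma lambda_ext_C0 f : CP0 R X P f -> C0 R Y (lambda_ext f).
Proof.
rewrite CP0E // => -[fb Pf].
have cext := @lambda_ext_continuous f; split.
  split=> //; apply/bounded_funP; exists (supnorm f) => p.
  exact: beta_ext_norm_le.
move=> n n0; have cK := compact_lambda_null_closure (@closed_closure _ (coz f)) Pf.
apply: (subclosed_compact _ cK); first exact: closed_superlevel cext.
move=> p /(superlevel_coz n0) /eqP /(beta_ext_neq0_interior fb) /interior_subset.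
by apply: closureS; apply: image_subset; exact: subset_closure.
Qed.

(** A function on Y vanishing at infinity has compact support, and this support
    lies in the closure of a null set A; its restriction to X then vanishes
    off A. *)
Lemma lambda_ext_surj : C0 R Y `<=` lambda_ext @` CP0 R X P.
Proof.
move=> g gC0; have [[cg /bounded_funP [M Mb]] csg] : C00 R Y g by rewrite -C0_lambda.
pose f x := g (iota_Y x).
have fb : Cb R X f.
  split; last by apply/bounded_funP; exists M => x; exact: Mb.
  move=> x; apply: continuous_comp; last exact: cg.
  by apply: subtype_continuous; exact: iota_beta_continuous.
exists f; last exact: lambda_ext_unique.
rewrite CP0E //; split=> //.
have [||A [cA PA gA]] := @compact_sub_lambda ((@set_val _ Y) @` supp g).
- apply: continuous_compact csg; apply: continuous_subspaceT.
  exact: set_val_continuous.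
- by move=> _ [p _ <-]; exact: set_valP.
apply: (property_closedS P_top P_closed _ _ PA); first exact: closed_closure.
rewrite [X in _ `<=` X](closure_id A).1 //; apply: closureS => x fx.
rewrite (closure_id A).1 //; apply: (closure_iotaE (R := R)) => //.
by apply: gA; exists (iota_Y x) => //; exact: subset_closure.
Qed.

Lemma CP0_isometric_C0 : isometrically_isomorphic (CP0 R X P) (C0 R Y).
Proof.
have CPb f : CP0 R X P f -> Cb R X f by case.
exists lambda_ext; split.
  split; [exact: lambda_ext_C0| |exact: lambda_ext_surj].
  move=> f g /set_mem /CPb fb /set_mem /CPb gb fg; apply/funext => x.
  by rewrite -(lambda_ext_iota x fb) fg lambda_ext_iota.
split=> [f g /CPb fb /CPb gb|a f /CPb fb|f g /CPb fb /CPb gb|f /CPb fb].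
- apply: lambda_ext_unique; first exact: CbD.
    by move=> p; exact: (cvgD (@lambda_ext_continuous f p)
      (@lambda_ext_continuous g p)).
  by move=> x; rewrite -[LHS]/(lambda_ext f (iota_Y x) + lambda_ext g (iota_Y x))
    !lambda_ext_iota.
- apply: lambda_ext_unique; first exact: CbZ.
    by move=> p; exact: (cvgM (cvg_cst a) (@lambda_ext_continuous f p)).
  by move=> x; rewrite -[LHS]/(a * lambda_ext f (iota_Y x)) lambda_ext_iota.
- apply: lambda_ext_unique; first exact: CbM.
    by move=> p; exact: (cvgM (@lambda_ext_continuous f p)
      (@lambda_ext_continuous g p)).
  by move=> x; rewrite -[LHS]/(lambda_ext f (iota_Y x) * lambda_ext g (iota_Y x))
    !lambda_ext_iota.
- have bext : bounded_fun (lambda_ext f).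
    by apply/bounded_funP; exists (supnorm f) => p; exact: beta_ext_norm_le.
  apply/eqP; rewrite eq_le; apply/andP; split; apply: supnorm_le => [|x];
    try exact: supnorm_ge0; first exact: beta_ext_norm_le.
  by rewrite -(lambda_ext_iota x fb); exact: supnorm_ubound.
Qed.

Lemma CP0_banach : banach_algebra (CP0 R X P).
Proof.
rewrite CP0E //.
have PsuppS (f : X -> R) (A : set X) : coz f `<=` A -> closed A -> P A -> P (supp f).
  move=> fA cA PA; apply: (property_closedS P_top P_closed _ _ PA).
    exact: closed_closure.
  by rewrite (closure_id A).1 //; exact: closureS.
have cs (f : X -> R) : closed (supp f) by exact: closed_closure.
have sc (f : X -> R) : coz f `<=` supp f by exact: subset_closure.
apply: Cb_subalgebra_banach => [f [] //||f g|a f|f g|u f].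
- split; first exact: Cb0.
  by rewrite /supp coz0 closure0; exact: property_set0.
- move=> [fb Pf] [gb Pg]; split; first exact: CbD.
  have [cU PU] := closed_propertyU (cs f) Pf (cs g) Pg.
  by apply: PsuppS cU PU; apply: subset_trans (@cozD _ _ f g) _; exact: setUSS.
- move=> [fb Pf]; split; first exact: CbZ.
  by apply: PsuppS (cs f) Pf; apply: subset_trans (@cozZ _ _ a f) _; exact: sc.
- move=> [fb Pf] [gb _]; split; first exact: CbM.
  by apply: PsuppS (cs f) Pf; apply: subset_trans (@cozM _ _ f g) _; exact: sc.
- move=> uP uf; split; first exact: uniform_limit_Cb (fun n => (uP n).1) uf.
  apply: (PsuppS _ (closure (\bigcup_(A in range (fun n => supp (u n))) A))).
  + move=> x /(uniform_limit_coz uf) [n _ ux]; apply: subset_closure.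
    by exists (supp (u n)); [exists n|exact: sc].
  + exact: closed_closure.
  + apply: property_closure_bigcup; first exact: sub_countable (card_image_le _ _) _.
    by move=> _ [n _ <-]; split; [exact: cs|exact: (uP n).2].
Qed.

End NormalNullSets.

End NullSets.

(** * Recovering a locally compact space from its function algebra *)

Section C0Functions.
Variables (R : realType) (Y : topologicalType).
Implicit Types f g : Y -> R.

(** The superlevel sets of f at 1/n lie in those of g at any 1/m below
    1/(c n); adding 1 to n and to the absolute value of c keeps the quotient
    meaningful for all c. *)
Lemma C0_dominated f g (c : R) : C0 R Y g -> continuous f ->
  (forall y, `|f y| <= c * `|g y|) -> C0 R Y f.
Proof.
move=> [[cg /bounded_funP [M Mb]] gK] cf fg.
have fg' y : `|f y| <= (`|c| + 1) * `|g y|.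
  apply: le_trans (fg y) _; apply: ler_wpM2r => //.
  by apply: le_trans (ler_norm c) _; rewrite lerDl.
have c0 : 0 < `|c| + 1 by apply: ltr_wpDl.
split.
  split=> //; apply/bounded_funP; exists ((`|c| + 1) * M) => y.
  by apply: le_trans (fg' y) _; rewrite ler_pM2l.
move=> n n0.
have [m nm] := ltr_add_invr (divr_gt0 (@ltr01 R) (mulr_gt0 (ltr0Sn R n) c0)).
rewrite add0r in nm.
apply: (subclosed_compact _ (gK m.+1 isT)); first exact: closed_superlevel.
move=> y; rewrite /superlevel /= => nf.
apply: le_trans (ltW nm) _; rewrite ler_pdivrMr ?mulr_gt0 ?ltr0Sn //.
have : n%:R * n%:R^-1 <= n%:R * `|f y| by rewrite ler_wpM2l.
rewrite divff ?pnatr_eq0 -?lt0n // => /le_trans; apply.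
have : n%:R * `|f y| <= n.+1%:R * `|f y| by rewrite ler_wpM2r // ler_nat.
move=> /le_trans; apply; rewrite [leRHS]mulrC -mulrA ler_wpM2l //.
Qed.

Lemma locally_compact_C0_Urysohn (y : Y) (U : set Y) :
  locally_compact [set: Y] -> hausdorff_space Y -> nbhs y U ->
  exists f, [/\ C0 R Y f, f y = 1 & forall x, ~ U x -> f x = 0].
Proof.
move=> lY hY yU; have [K yK [cK clK]] := lY y I.
have crY := @locally_compact_completely_regular Y R lY hY.
pose W := (K `&` U)°.
have yW : W y.
  by apply: filterI => //; apply: (@filterS _ (nbhs y) _ _ _ _ yK) => x; exact.
have /(@uniform_separatorP _ R) [f [cf f01 fy fW]] :
    uniform_separator [set y] (~` W).
  by apply: crY; [exact: open_closedC (open_interior _)|exact].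
have fb x : 0 <= f x <= 1.
  by have : `[0, 1]%classic (f x) by [apply: f01; exists x]; rewrite /= in_itv.
have fnK x : ~ (K `&` U) x -> f x = 1.
  by move=> nKU; apply: fW; exists x => // /interior_subset.
exists (fun x => 1 - f x); split.
- have cg : continuous (fun x => 1 - f x).
    by move=> x; apply: cvgB; [exact: cvg_cst|exact: cf].
  split; first split=> //.
    apply/bounded_funP; exists 1 => x; have /andP[f0 f1] := fb x.
    by rewrite ger0_norm ?subr_ge0 // lerBlDr lerDl.
  move=> n n0; apply: (subclosed_compact _ cK); first exact: closed_superlevel.
  move=> x /(superlevel_coz n0) /= fx; apply: contrapT => nKx; apply: fx.
  by rewrite /= fnK ?subrr // => -[].
- by rewrite /= (fy (f y)) ?subr0 //; exists y.
- by move=> x nUx; rewrite /= fnK ?subrr // => -[].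
Qed.

End C0Functions.

Section BanachStone.
Variables (R : realType) (S : Type) (A : set (S -> R)).
Hypothesis A_alg : banach_algebra A.

(** The condition on the map in [isometrically_isomorphic], with the map made
    explicit so that two of them can be compared. *)
Definition isometric_isomorphism (T : Type) (B : set (T -> R))
    (phi : (S -> R) -> (T -> R)) :=
  set_bij A B phi /\
    [/\ forall f g, A f -> A g -> phi (f + g) = phi f + phi g,
        forall (a : R) f, A f -> phi (a *: f) = a *: phi f,
        forall f g, A f -> A g -> phi (f * g) = phi f * phi g &
        forall f, A f -> supnorm (phi f) = supnorm f].

Section Character.
Variables (Y Z : topologicalType).
Variables (phi : (S -> R) -> (Y -> R)) (psi : (S -> R) -> (Z -> R)).
Hypothesis phi_iso : isometric_isomorphism (C0 R Y) phi.
Hypothesis psi_iso : isometric_isomorphism (C0 R Z) psi.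

(** Suppose that for every y some f in the kernel of evaluation at z satisfies
    phi f y <> 0. A finite sum of squares of such f is an h in the kernel which
    is at least some d > 0 on the compact set where |phi g| >= 1/2. For a large
    constant c the function phi g / (1 + c phi h) differs from phi g by an
    element of the image of the kernel, yet has norm at most 1/2; since
    evaluation at z is contractive this contradicts psi g z = 1. *)
Lemma character_kernel_point (z : Z) (g : S -> R) : A g -> psi g z = 1 ->
  exists y, forall f, A f -> psi f z = 0 -> phi f y = 0.
Proof.
have [[phiA _ phi_surj] [phiD phiZ phiM phiN]] := phi_iso.
have [[psiA _ _] [psiD psiZ psiM psiN]] := psi_iso.
move=> Ag gz; apply: contrapT => /forallNP nker.
have ker y : exists f, [/\ A f, psi f z = 0 & phi f y != 0].
  have /existsNP [f /not_implyP [Af /not_implyP [fz /eqP fy]]] := nker y.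
  by exists f.
have [h [Ah hz h_ge0 [d d0 hd]]] : exists h, [/\ A h, psi h z = 0,
    forall y, 0 <= phi h y &
    exists2 d, 0 < d & forall y, superlevel (phi g) 2 y -> d <= phi h y].
  apply: (compact_ideal (J := fun L => exists h, [/\ A h, psi h z = 0,
    forall y, 0 <= phi h y & exists2 d, 0 < d & forall y, L y -> d <= phi h y])).
  - exact: (phiA g Ag).2.
  (* 0 as a multiple of g, so that linearity on A computes its images. *)
  - exists (0 *: g); split; first exact: (banachZ A_alg).
    + by rewrite psiZ //; exact: mul0r.
    + by move=> y; rewrite phiZ // -[leRHS]/(0 * phi g y) mul0r.
    + by exists 1.
  - move=> L1 L2 [h1 [A1 z1 p1 [d1 d10 L1d]]] [h2 [A2 z2 p2 [d2 d20 L2d]]].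
    exists (h1 + h2); split; first exact: (banachD A_alg).
    + by rewrite psiD // -[LHS]/(psi h1 z + psi h2 z) z1 z2 addr0.
    + by move=> y; rewrite phiD // addr_ge0.
    + exists (Num.min d1 d2); first by rewrite lt_min d10.
      move=> y; rewrite phiD // -[leRHS]/(phi h1 y + phi h2 y) => -[/L1d|/L2d] dy.
        by rewrite ge_min; apply/orP; left; apply: le_trans dy _; rewrite lerDl.
      by rewrite ge_min; apply/orP; right; apply: le_trans dy _; rewrite lerDr.
  - move=> L1 L2 L12 [h [Ah hz hp [d d0 Ld]]]; exists h; split=> //.
    by exists d => // y /L12 /Ld.
  - move=> y _; have [f [Af fz fy]] := ker y.
    have fE x : phi (f * f) x = phi f x ^+ 2 by rewrite phiM // expr2.
    have e0 : 0 < phi f y ^+ 2 / 2 by rewrite divr_gt0 // exprn_even_gt0.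
    exists [set x | phi f y ^+ 2 / 2 < phi (f * f) x].
      apply: open_nbhs_nbhs; split.
        apply: (@open_comp _ _ (phi (f * f)) [set r | phi f y ^+ 2 / 2 < r]).
          by move=> x _; exact: (phiA _ (banachM A_alg Af Af)).1.1.
        exact: open_gt.
      by rewrite /= fE ltr_pdivrMr // ltr_pMr ?exprn_even_gt0 // ltr1n.
    exists (f * f); split.
    + exact: (banachM A_alg).
    + by rewrite psiM // -[LHS]/(psi f z * psi f z) fz mul0r.
    + by move=> x; rewrite fE sqr_ge0.
    + by exists (phi f y ^+ 2 / 2) => // x /ltW.
have M0 : 0 < supnorm (phi g) + 1 by rewrite ltr_wpDl // supnorm_ge0.
(* This c makes 1 + c d at least twice the norm of phi g. *)
have [c c0 cd] : exists2 c, 0 < c & c * d = 2 * (supnorm (phi g) + 1).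
  exists (2 * (supnorm (phi g) + 1) / d); first by rewrite divr_gt0 // mulr_gt0.
  by rewrite divfK // gt_eqF.
have den1 y : 1 <= 1 + c * phi h y by rewrite lerDl mulr_ge0 // ltW.
have den0 y : 0 < 1 + c * phi h y by apply: lt_le_trans (den1 y).
(* phi h * k is what must be subtracted from phi g to leave
   phi g / (1 + c phi h). *)
pose k y := c * phi g y / (1 + c * phi h y).
have [[cg bg] _] := phiA g Ag; have [[ch _] _] := phiA h Ah.
have kC0 : C0 R Y k.
  apply: (@C0_dominated _ _ _ (phi g) c); first exact: phiA.
    move=> y; apply: cvgM; first by apply: cvgM; [exact: cvg_cst|exact: cg].
    apply: cvgV; first by rewrite gt_eqF.
    by apply: cvgD; [exact: cvg_cst|apply: cvgM; [exact: cvg_cst|exact: ch]].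
  move=> y; rewrite /k !normrM (gtr0_norm c0) normfV (gtr0_norm (den0 y)).
  by rewrite ler_pdivrMr // ler_peMr // mulr_ge0 // ltW.
have [q Aq qk] := phi_surj k kC0.
have Ahq : A (h * q) by exact: (banachM A_alg).
pose u := g + (-1) *: (h * q).
have Au : A u by apply: (banachD A_alg) => //; exact: (banachZ A_alg).
have uz : psi u z = 1.
  rewrite /u psiD ?psiZ ?psiM //; last exact: (banachZ A_alg).
  by rewrite -[LHS]/(psi g z + (-1) * (psi h z * psi q z)) hz mul0r mulr0 addr0.
have uE y : phi u y = phi g y / (1 + c * phi h y).
  rewrite /u phiD ?phiZ ?phiM //; last exact: (banachZ A_alg).
  rewrite -[LHS]/(phi g y + (-1) * (phi h y * phi q y)) qk /k.
  by field; rewrite gt_eqF.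
have : supnorm (psi u) <= 2^-1.
  rewrite psiN // -phiN //; apply: supnorm_le => [|y]; first by rewrite invr_ge0.
  rewrite uE normrM normfV (gtr0_norm (den0 y)) ler_pdivrMr //.
  have [gy|gy] := leP 2^-1 `|phi g y|; last first.
    by apply: le_trans (ltW gy) _; rewrite ler_peMr // invr_ge0.
  have := hd y gy; have := supnorm_ubound y bg.
  move=> gM dh; have : c * d <= c * phi h y by rewrite ler_pM2l.
  by rewrite cd; lra.
have := @supnorm_ubound _ _ (psi u) z (psiA u Au).1.2.
by rewrite uz normr1 => /le_trans /[apply]; rewrite invf_ge1 // lern1.
Qed.

(** The kernel of evaluation at z has codimension one, so a point y where the
    kernel vanishes represents evaluation at z up to a scalar, and
    multiplicativity forces this scalar to be 1. *)
Lemma character_point (z : Z) :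
  (exists2 g, C0 R Z g & g z = 1) -> (forall y, exists2 g, C0 R Y g & g y = 1) ->
  exists y, forall f, A f -> phi f y = psi f z.
Proof.
move=> [k kC0 kz] Y1.
have [[phiA _ phi_surj] [phiD phiZ phiM phiN]] := phi_iso.
have [[psiA _ psi_surj] [psiD psiZ psiM psiN]] := psi_iso.
have [g Ag gk] := psi_surj k kC0; have gz : psi g z = 1 by rewrite gk.
have [y ker] := character_kernel_point Ag gz.
have fE f : A f -> phi f y = psi f z * phi g y.
  move=> Af; pose a := - psi f z.
  have Aag : A (a *: g) by exact: (banachZ A_alg).
  have : phi (f + a *: g) y = 0.
    apply: ker; first exact: (banachD A_alg).
    by rewrite psiD // psiZ // -[LHS]/(psi f z + - psi f z * psi g z) gz; ring.
  rewrite phiD // phiZ // -[LHS]/(phi f y + - psi f z * phi g y) mulNr.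
  by move/eqP; rewrite subr_eq0 => /eqP.
have [k' k'C0 k'y] := Y1 y; have [g' Ag' gk'] := phi_surj k' k'C0.
have gy0 : phi g y != 0.
  apply/eqP => gy0; have := fE g' Ag'; rewrite gk' k'y gy0 mulr0.
  by move/eqP; rewrite oner_eq0.
have gy1 : phi g y = 1.
  apply: (mulfI gy0); rewrite mulr1 -[LHS]/((phi g * phi g) y) -phiM //.
  rewrite fE; last exact: (banachM A_alg).
  by rewrite psiM // -[X in X * _]/(psi g z * psi g z) gz !mul1r.
by exists y => f Af; rewrite fE // gy1 mulr1.
Qed.

(** The topology of a locally compact Hausdorff space is determined by its
    functions vanishing at infinity, and these pull back to continuous
    functions along s. *)
Lemma character_map_continuous (s : Z -> Y) :
  locally_compact [set: Y] -> hausdorff_space Y ->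
  (forall z f, A f -> phi f (s z) = psi f z) -> continuous s.
Proof.
move=> lY hY sE z U szU.
have [[phiA _ phi_surj] _] := phi_iso; have [[psiA _ _] _] := psi_iso.
have [g [gC0 gz gU]] := locally_compact_C0_Urysohn R lY hY szU.
have [f Af fg] := phi_surj g gC0.
have cf := (psiA f Af).1.1.
have : nbhs z [set w | psi f w != 0].
  apply: open_nbhs_nbhs; split; first exact: open_neq0.
  by rewrite /= -sE // fg gz oner_eq0.
apply: filterS => w /= fw; apply: contrapT => nU; move: fw.
by rewrite -sE // fg gU // eqxx.
Qed.

Lemma C0_separates (y y' : Y) :
  locally_compact [set: Y] -> hausdorff_space Y ->
  (forall f, A f -> phi f y = phi f y') -> y = y'.
Proof.
move=> lY hY yy'; have [[_ _ phi_surj] _] := phi_iso.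
apply: contrapT => ny.
have yU : nbhs y (~` [set y']).
  apply: open_nbhs_nbhs; split=> //; apply: closed_openC.
  by apply: accessible_closed_set1; exact: hausdorff_accessible.
have [g [gC0 gy gU]] := locally_compact_C0_Urysohn R lY hY yU.
have [f Af fg] := phi_surj g gC0.
have := yy' f Af; rewrite fg gy gU; last by apply.
by move/eqP; rewrite oner_eq0.
Qed.

End Character.

Lemma C0_nonvanishing (Y : topologicalType) (y : Y) :
  locally_compact [set: Y] -> hausdorff_space Y -> exists2 g, C0 R Y g & g y = 1.
Proof.
move=> lY hY.
by have [g [gC0 gy _]] := locally_compact_C0_Urysohn R lY hY (@filterT _ (nbhs y) _);
  exists g.
Qed.

Theorem banach_stone (Y Z : topologicalType) :
  locally_compact [set: Y] -> hausdorff_space Y ->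
  locally_compact [set: Z] -> hausdorff_space Z ->
  isometrically_isomorphic A (C0 R Y) -> isometrically_isomorphic A (C0 R Z) ->
  homeomorphic Z Y.
Proof.
move=> lY hY lZ hZ [phi phi_iso] [psi psi_iso].
have pick_s z : exists y, forall f, A f -> phi f y = psi f z.
  apply: (character_point phi_iso psi_iso); first exact: C0_nonvanishing.
  by move=> y; exact: C0_nonvanishing.
have pick_t y : exists z, forall f, A f -> psi f z = phi f y.
  apply: (character_point psi_iso phi_iso); first exact: C0_nonvanishing.
  by move=> z; exact: C0_nonvanishing.
pose s z := projT1 (cid (pick_s z)); pose t y := projT1 (cid (pick_t y)).
have sE z f : A f -> phi f (s z) = psi f z by rewrite /s; case: cid => y /= yP /yP.
have tE y f : A f -> psi f (t y) = phi f y by rewrite /t; case: cid => z /= zP /zP.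
exists s, t; split.
- exact: (character_map_continuous phi_iso psi_iso).
- exact: (character_map_continuous psi_iso phi_iso).
- by move=> z; apply: (C0_separates psi_iso) => // f Af; rewrite tE // sE.
- by move=> y; apply: (C0_separates phi_iso) => // f Af; rewrite sE // tE.
Qed.

End BanachStone.

Theorem theorem7p10 (R : realType) (P Q : topologicalType -> Prop)
    (P_top : topological_property P) (Q_top : topological_property Q)
    (P_closed : closed_hereditary P) (Q_closed : closed_hereditary Q)
    (PQ_lindelof : forall T : topologicalType, P T -> Q T -> lindelof T)
    (P_sums : preserved_under_countable_closed_sums P)
    (P_dense : forall T : topologicalType, Q T ->
       (exists2 D : set T, dense D & P D) -> P T)
    (X : topologicalType) (X_loc : locally_property P X) (X_Q : Q X) :
  (regular_space X ->
     CP0 R X P = [set f | Cb R X f /\ P (supp f)] /\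
     [set f | Cb R X f /\ P (supp f)] = CP00 R X P) /\
  (normal_space X -> hausdorff_space X ->
     let Y : topologicalType := lambda R P X in
     banach_algebra (CP0 R X P) /\
     [/\ locally_compact [set: Y], hausdorff_space Y &
         isometrically_isomorphic (CP0 R X P) (C0 R Y)] /\
     (forall Z : topologicalType,
        locally_compact [set: Z] -> hausdorff_space Z ->
        isometrically_isomorphic (CP0 R X P) (C0 R Z) -> homeomorphic Z Y) /\
     countably_compact Y /\
     C0 R Y = C00 R Y).
Proof.
split=> [X_reg|Xn Xh Y].
  have E0 := CP0E P_top P_closed Q_closed PQ_lindelof
      P_sums P_dense X_loc X_Q X_reg R.
  have E00 := CP00E P_top P_closed Q_closed PQ_lindelof
      P_sums P_dense X_loc X_Q X_reg R.
  by split; rewrite ?E0 ?E00.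
have lY : locally_compact [set: Y].
  exact: (lambda_locally_compact P_top P_closed Q_closed PQ_lindelof
      P_sums P_dense X_loc X_Q Xn Xh).
have hY : hausdorff_space Y by exact: lambda_hausdorff.
have bA : banach_algebra (CP0 R X P).
  exact: (CP0_banach P_top P_closed Q_closed PQ_lindelof
      P_sums P_dense X_loc X_Q R Xn Xh).
have isoY : isometrically_isomorphic (CP0 R X P) (C0 R Y).
  exact: (CP0_isometric_C0 P_top P_closed Q_closed PQ_lindelof
      P_sums P_dense X_loc X_Q R Xn Xh).
split=> //; split=> //; split; last split.
- by move=> Z lZ hZ isoZ; exact: (banach_stone bA lY hY lZ hZ isoY isoZ).
- exact: (lambda_countably_compact P_top P_closed Q_closed PQ_lindelof
      P_sums P_dense X_loc X_Q Xn Xh).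
- exact: (C0_lambda P_top P_closed Q_closed PQ_lindelof
      P_sums P_dense X_loc X_Q R Xn Xh).
Qed.
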